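(* Let $f^N$ (together with $E^N$) be the exact solution of the truncated Vlasov-Poisson system $$\mathcal{P}^N\left(\frac{\partial f^N}{\partial t}+v\frac{\partial f^N}{\partial x}-E^N\frac{\partial f^N}{\partial v}\right)=R^N,\qquad \mathcal{P}^N_F\left(\frac{\partial E^N}{\partial x}-\rho^N\right)=0,\qquad \rho^N=1-\int_{\Omega_v}f^N\,dv,$$ on the domain $\Omega=\Omega_x\times\Omega_v$, with initial condition $f^N(\cdot,\cdot,0)=\mathcal{P}^Nf_0$. Then $$\frac{d}{dt}\|f^N(\cdot,\cdot,t)\|_{L^2(\Omega)}^2=0,$$ or, equivalently, $\|f^N(\cdot,\cdot,t)\|_{L^2(\Omega)}=\|\mathcal{P}^Nf_0\|_{L^2(\Omega)}$ for every $t\in[0,T[$.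
   Context: $\Omega_x=[0,2\pi[$ (periodic in $x$), $\Omega_v=]v_{\min},v_{\max}[$, $T$ finite, $f_0$ the given initial distribution function. Distribution functions and electric fields are real-valued. Bases: $\eta_k(x)=\frac{1}{\sqrt{2\pi}}e^{ikx}$, $k\in\mathbb{Z}$. $\{\varphi_n\}_{n\ge0}$ is either (Legendre-Fourier method) the Legendre polynomials mapped affinely from $[-1,1]$ to $[v_{\min},v_{\max}]$ and normalized, or (Hermite-Fourier method, with velocity domain restricted to $]v_{\min},v_{\max}[$) the symmetrically weighted Hermite functions, i.e. suitably normalized Hermite polynomials times $e^{-v^2/2}$. They are taken to satisfy the orthogonality property $\int_{\Omega_v}\varphi_n\varphi_{n'}\,dv=\delta_{n,n'}$. Spaces and projections: for positive integers $N_S,N_F$ and $N=(N_S,N_F)$, $\mathcal{S}^N=\mathrm{span}\{\varphi_n\}_{0\le n\le N_S-1}$, $\mathcal{F}^N=\mathrm{span}\{\eta_k\}_{-N_F\le k\le N_F}$, $\mathcal{X}^N=\mathrm{span}\{\eta_k\varphi_n\}_{|k|\le N_F,\,0\le n\le N_S-1}$. $\mathcal{P}^N_S$, $\mathcal{P}^N_F$ are the $L^2$-orthogonal projections onto $\mathcal{S}^N$ (in $v$) and $\mathcal{F}^N$ (in $x$), and $\mathcal{P}^N=\mathcal{P}^N_S\circ\mathcal{P}^N_F=\mathcal{P}^N_F\circ\mathcal{P}^N_S$ is the orthogonal projection of $L^2(\Omega)$ onto $\mathcal{X}^N$. The unknowns are $f^N(\cdot,\cdot,t)\in\mathcal{X}^N$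 and $E^N(\cdot,t)\in\mathcal{F}^N$. Penalty term: $$R^N(x,v,t)=-\tfrac12\mathcal{P}^N\Big(E^N(x,t)\Big[f^N(x,v_{\max},t)\sum_{n=0}^{N_S-1}\varphi_n(v_{\max})\varphi_n(v)-f^N(x,v_{\min},t)\sum_{n=0}^{N_S-1}\varphi_n(v_{\min})\varphi_n(v)\Big]\Big).$$ The field $E^N$ is normalized to have zero mean: its Fourier coefficients with respect to $\eta_k$ are $E^N_0=0$ and $E^N_k(t)=\frac ik\int_{\Omega}f^N\eta_{-k}\,dx\,dv$ for $0<|k|\le N_F$. *)

(* Defs.v *)
From HB Require Import structures.
From mathcomp Require Import all_boot all_order all_algebra.
From mathcomp Require Import complex.
From mathcomp Require Import all_classical all_reals all_analysis.

Set Implicit Arguments.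
Unset Strict Implicit.
Unset Printing Implicit Defensive.

Import Order.TTheory GRing.Theory Num.Theory.
Import numFieldNormedType.Exports.

Local Open Scope classical_set_scope.
Local Open Scope ring_scope.
Local Open Scope complex_scope.

Section ComplexL2.
Context {d : measure_display} {T : measurableType d} {R : realType}.
Variables (mu : {measure set T -> \bar R}) (D : set T).

Definition Cintegral (g : T -> R[i]) : R[i] :=
  (\int[mu]_(z in D) complex.Re (g z)) +i* (\int[mu]_(z in D) complex.Im (g z)).

Definition L2inner (g h : T -> R[i]) : R[i] :=
  Cintegral (fun z => g z * (h z)^*).

Definition L2norm (g : T -> R[i]) : R :=
  Num.sqrt (complex.Re (L2inner g g)).

(* [h] is the orthogonal projection of [g] onto the subspace [V] of
   L^2(D, mu; C). For finite-dimensional [V] and square-integrable [g]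
   such an [h] exists; its class in L^2 is unique. *)
Definition orthogonal_projection (V : set (T -> R[i])) (g h : T -> R[i]) :=
  V h /\ forall w, V w -> L2inner (fun z => g z - h z) w = 0.

End ComplexL2.

Section Bases.
Context {R : realType}.

Definition eta (k : int) (x : R) : R[i] :=
  ((Num.sqrt (2 * pi))^-1)%:C * (cos (k%:~R * x) +i* sin (k%:~R * x)).

(* Rodrigues' formula *)
Definition legendre (n : nat) : {poly R} :=
  ((2 ^ n * n`!)%N%:R)^-1 *: (('X^2 - 1) ^+ n)^`(n).

(* physicists' Hermite polynomials: H_0 = 1, H_(n+1) = 2 X H_n - H_n' *)
Definition hermite (n : nat) : {poly R} :=
  iter n (fun p => 2%:R *: ('X * p) - p^`()) 1.

(* In the three families below the normalization is left free (the
   coefficients [c n], the polynomials [p n]); it is fixed up to sign by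
   [orthonormal_upto]. *)
Definition legendre_family (vmin vmax : R) (phi : nat -> R -> R) :=
  exists c : nat -> R, forall n v,
    phi n v = c n * (legendre n).[(2 * v - vmin - vmax) / (vmax - vmin)].

Definition hermite_family (phi : nat -> R -> R) :=
  exists c : nat -> R, forall n v,
    phi n v = c n * (hermite n).[v] * expR (- (v ^+ 2) / 2).

(* The classical Hermite functions are orthogonal on the whole line; on a
   bounded interval three or more of them are never exactly orthonormal.
   This family keeps the shape "polynomial of degree n times exp(-v^2/2)" and
   lets orthonormality on ]vmin, vmax[ select the polynomials, so that the
   weighted case is not restricted to at most two modes. *)
Definition restricted_hermite_family (phi : nat -> R -> R) :=
  exists2 p : nat -> {poly R}, forall n, size (p n) = n.+1 &
    forall n v, phi n v = (p n).[v] * expR (- (v ^+ 2) / 2).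

Definition velocity_basis (vmin vmax : R) (phi : nat -> R -> R) :=
  [\/ legendre_family vmin vmax phi,
      hermite_family phi
    | restricted_hermite_family phi].

Definition orthonormal_upto (vmin vmax : R) (NS : nat) (phi : nat -> R -> R) :=
  forall n m : nat, (n < NS)%N -> (m < NS)%N ->
    \int[lebesgue_measure]_(v in `]vmin, vmax[) (phi n v * phi m v)
      = (n == m)%:R.

(* In both spaces, the index j encodes the wave number k = j - NF, so that k
   runs from -NF to NF. *)
Definition spaceF (NF : nat) : set (R -> R[i]) :=
  [set g | exists c : int -> R[i], forall x,
    g x = \sum_(0 <= j < (2 * NF).+1)
            c (j%:Z - NF%:Z) * eta (j%:Z - NF%:Z) x].

Definition spaceX (NS NF : nat) (phi : nat -> R -> R)
    : set (R * R -> R[i]) :=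
  [set g | exists c : int -> nat -> R[i], forall z,
    g z = \sum_(0 <= j < (2 * NF).+1) \sum_(0 <= n < NS)
            c (j%:Z - NF%:Z) n * (eta (j%:Z - NF%:Z) z.1 * (phi n z.2)%:C)].

End Bases.

Section VlasovPoisson.
Context {R : realType}.

Local Notation RR := (measurableTypeR R * measurableTypeR R)%type.

Definition leb2 : {measure set RR -> \bar R} :=
  [the {measure set RR -> \bar R} of
     (@lebesgue_measure R \x @lebesgue_measure R)%E].

Definition Omegax : set R := `[0, 2 * pi[.
Definition Omegav (vmin vmax : R) : set R := `]vmin, vmax[.
Definition Omega (vmin vmax : R) : set (R * R) := Omegax `*` Omegav vmin vmax.

Definition L2_Omega (vmin vmax : R) (g : R -> R -> R) :=
  measurable_fun (Omega vmin vmax) (fun z : RR => g z.1 z.2) /\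
  leb2.-integrable (Omega vmin vmax) (fun z => ((g z.1 z.2) ^+ 2)%:E).

(* a real distribution function f(x, v, t) at time t, as a complex-valued
   function on phase space *)
Definition slice (f : R -> R -> R -> R) (t : R) : R * R -> R[i] :=
  fun z => (f z.1 z.2 t)%:C.

Definition projX (vmin vmax : R) (NS NF : nat) (phi : nat -> R -> R) :=
  orthogonal_projection leb2 (Omega vmin vmax) (spaceX NS NF phi).

Definition projF (NF : nat) :=
  orthogonal_projection (@lebesgue_measure R) Omegax (spaceF NF).

Definition vlasov (f : R -> R -> R -> R) (E : R -> R -> R) (t : R)
    (z : R * R) : R :=
  derive1 (f z.1 z.2) t
  + z.2 * derive1 (fun y => f y z.2 t) z.1
  - E z.1 t * derive1 (fun w => f z.1 w t) z.2.

Definition boundary_term (vmin vmax : R) (NS : nat) (phi : nat -> R -> R)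
    (f : R -> R -> R -> R) (E : R -> R -> R) (t : R) (z : R * R) : R :=
  E z.1 t *
  (f z.1 vmax t * (\sum_(0 <= n < NS) phi n vmax * phi n z.2)
   - f z.1 vmin t * (\sum_(0 <= n < NS) phi n vmin * phi n z.2)).

Definition is_penalty (vmin vmax : R) (NS NF : nat) (phi : nat -> R -> R)
    (f : R -> R -> R -> R) (E : R -> R -> R) (t : R) (RN : R * R -> R[i]) :=
  exists2 P : R * R -> R[i],
    projX vmin vmax NS NF phi
      (fun z => (boundary_term vmin vmax NS phi f E t z)%:C) P &
    forall z, RN z = - (2^-1)%:C * P z.

Definition charge_density (vmin vmax : R) (f : R -> R -> R -> R) (x t : R) : R :=
  1 - \int[lebesgue_measure]_(v in Omegav vmin vmax) f x v t.

(* [f] and [E] solve the truncated system on [0, T[ with initial datum [Pf0].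
   The functions are defined on the whole real lines in x and v, where the
   elements of the discrete spaces have their natural extensions. In time the
   solution is classical: continuous on [0, T[ and differentiable on ]0, T[. *)
Record truncated_vlasov_poisson (vmin vmax T : R) (NS NF : nat)
    (phi : nat -> R -> R) (f0 : R -> R -> R) (Pf0 : R * R -> R[i])
    (f : R -> R -> R -> R) (E : R -> R -> R) : Prop := {
  tvp_f_space : forall t, 0 <= t < T -> spaceX NS NF phi (slice f t);
  tvp_E_space : forall t, 0 <= t < T -> spaceF NF (fun x => (E x t)%:C);
  tvp_f_continuous : forall x v, {within `[0, T[, continuous (f x v)};
  tvp_f_derivable : forall x v t, 0 < t < T -> derivable (f x v) t 1;
  tvp_vlasov : forall t, 0 < t < T ->
    exists2 RN : R * R -> R[i],
      is_penalty vmin vmax NS NF phi f E t RN &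
      projX vmin vmax NS NF phi (fun z => (vlasov f E t z)%:C) RN;
  tvp_poisson : forall t, 0 <= t < T ->
    projF NF
      (fun x => (derive1 (fun y => E y t) x - charge_density vmin vmax f x t)%:C)
      (fun=> 0);
  tvp_E_zero_mean : forall t, 0 <= t < T ->
    L2inner (@lebesgue_measure R) Omegax (fun x => (E x t)%:C) (eta 0) = 0;
  tvp_E_coef : forall t (k : int), 0 <= t < T -> k != 0 -> `|k| <= NF%:Z ->
    L2inner (@lebesgue_measure R) Omegax (fun x => (E x t)%:C) (eta k)
    = 'i / k%:~R *
      Cintegral leb2 (Omega vmin vmax) (fun z => slice f t z * eta (- k) z.1);
  tvp_projected_datum :
    projX vmin vmax NS NF phi (fun z => (f0 z.1 z.2)%:C) Pf0;
  tvp_initial : slice f 0 = Pf0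
}.

End VlasovPoisson.

(* Main.v *)
Require Import Defs.
From mathcomp Require Import all_boot all_order all_algebra.
From mathcomp Require Import complex.
From mathcomp Require Import all_classical all_reals all_analysis.
From mathcomp Require Import measurable_realfun ring.

(** The discrete solution f(., ., t) is an admissible test function for its own
    equation, since it belongs to the discrete space. Testing with it gives

      <f_t, f> + <v f_x, f> - <E f_v, f> = <R, f>.

    The transport term vanishes because f is periodic in x
    ([transport_no_work]). Integrating the field term by parts in v leaves half
    the boundary flux K, the integral over x of
    E(x) (f(x, vmax)^2 - f(x, vmin)^2) ([field_work]). By orthonormality of the
    phi_n, the sum of phi_n(w) phi_n(v) over n is the reproducing kernel of the
    velocity space: integrating it against f(x, .) returns f(x, w). Hence the
    boundary term inside the projection tests to exactly K ([boundary_work]) and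
    the penalty to - K / 2, which cancels the field term. So <f_t, f> = 0
    ([time_derivative_orthogonal]).

    It remains to see that <f_t, f> is half the derivative of the squared norm.
    The solution is only assumed differentiable in t at each point (x, v), so
    differentiating under the integral is not directly justified. But a
    finite-dimensional space of functions is determined by finitely many point
    evaluations ([finite_span_interpolation]), so
    f(x, v, t) = \sum_i f(p_i, t) g_i(x, v) for fixed points p_i and fixed
    functions g_i. The squared norm is then a quadratic form, with constant
    coefficients, in the finitely many differentiable functions f(p_i, .). It is
    continuous up to t = 0, so the mean value theorem turns its vanishing
    derivative into conservation from the initial time on. *)

Set Implicit Arguments.
Unset Strict Implicit.
Unset Printing Implicit Defensive.

Import Order.TTheory GRing.Theory Num.Theory.
Import numFieldNormedType.Exports.

Local Open Scope classical_set_scope.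
Local Open Scope ring_scope.
Local Open Scope complex_scope.

(** * Interpolation in a finite-dimensional space of functions *)

Lemma sum_closed (Z : Type) (K : nmodType) (V : set (Z -> K)) (I : Type)
    (s : seq I) (F : I -> Z -> K) :
  V (fun=> 0) ->
  (forall g h, V g -> V h -> V (fun z => g z + h z)) ->
  (forall i, V (F i)) -> V (fun z => \sum_(i <- s) F i z).
Proof.
move=> V0 VD VF; elim: s => [|i s IHs].
  rewrite (_ : (fun _ => _) = fun=> 0)//.
  by apply/funext => z; rewrite big_nil.
rewrite (_ : (fun _ => _) = fun z => F i z + \sum_(i <- s) F i z).
  exact: VD.
by apply/funext => z; rewrite big_cons.
Qed.

(** By induction on the generators. For a new generator b, the residual r of its
    interpolation by the previous data is either identically zero, and nothing
    has to be added, or nonzero at some point zs. In that case zs is added: every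
    h in the larger span differs from its old interpolant by a multiple of r, and
    h(zs) determines the multiple. The predicate V records any property stable
    under linear combinations, to be inherited by the interpolating functions. *)
Lemma finite_span_interpolation (Z I : Type) (K : fieldType) (z0 : Z)
    (V : set (Z -> K)) (b : I -> Z -> K) (s : seq I) :
  V (fun=> 0) ->
  (forall a g h, V g -> V h -> V (fun z => a * g z + h z)) ->
  (forall i, V (b i)) ->
  exists m (p : nat -> Z) (g : nat -> Z -> K), (forall i, V (g i)) /\
    forall c : I -> K, let h z := \sum_(i <- s) c i * b i z in
      forall z, h z = \sum_(i < m) h (p i) * g i z.
Proof.
move=> V0 VD Vb; have VZ a g : V g -> V (fun z => a * g z).
  move=> Vg; have := VD a _ _ Vg V0.
  by congr V; apply/funext => z; rewrite addr0.
have Vsum m (p : nat -> K) (g : nat -> Z -> K) : (forall i, V (g i)) ->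
    V (fun z => \sum_(i < m) p i * g i z).
  move=> Vg; apply: (@sum_closed _ _ _ _ _ (fun (i : 'I_m) z => p i * g i z)).
  - exact: V0.
  - move=> g1 g2 V1 V2; have := VD 1 _ _ V1 V2.
    by congr V; apply/funext => z; rewrite mul1r.
  - by move=> i; exact: VZ.
elim: s => [|i0 s [m [p [g [Vg IHs]]]]].
  exists 0%N, (fun=> z0), (fun=> fun=> 0); split=> // c h z.
  by rewrite /h big_ord0 big_nil.
pose r z := b i0 z - \sum_(i < m) b i0 (p i) * g i z.
have Vr : V r.
  have := VD (-1) _ _ (Vsum m (fun i => b i0 (p i)) g Vg) (Vb i0).
  by congr V; apply/funext => z; rewrite mulN1r addrC.
have resid c z : \sum_(i <- i0 :: s) c i * b i z
      - \sum_(j < m) (\sum_(i <- i0 :: s) c i * b i (p j)) * g j z = c i0 * r z.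
  under [X in _ - X]eq_bigr do rewrite big_cons mulrDl.
  rewrite big_cons big_split/= -IHs opprD addrACA subrr addr0 /r mulrBr.
  by congr (_ - _); rewrite mulr_sumr; under eq_bigr do rewrite -mulrA.
have [r0|/existsNP[zs /eqP rzs]] := pselect (forall z, r z = 0).
  exists m, p, g; split=> // c h z.
  by apply/eqP; rewrite -subr_eq0 resid r0 mulr0.
exists m.+1, (fun i => if i is j.+1 then p j else zs),
  (fun i => if i is j.+1 then fun z => - (g j zs / r zs) * r z + g j z
            else fun z => (r zs)^-1 * r z).
split; first by case=> [|j]; [exact: VZ|exact: VD].
move=> c h z; rewrite big_ord_recl/=.
have hr y : h y = \sum_(i < m) h (p i) * g i y + c i0 * r y.
  by rewrite -resid addrC subrK.
have cE : c i0 = (h zs - \sum_(i < m) h (p i) * g i zs) / r zs.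
  by rewrite hr addrC addKr mulfK.
rewrite [LHS]hr cE.
under [X in _ = _ + X]eq_bigr do rewrite mulrDr.
rewrite big_split/= [RHS]addrA [LHS]addrC; congr (_ + _).
rewrite !mulrBl !mulrA; congr (_ + _).
rewrite mulr_suml mulr_suml -sumrN; apply: eq_bigr => i _.
by rewrite mulNr mulrN !mulrA.
Qed.

(** * Continuously differentiable functions of one variable *)

Section C1.
Context {R : realType}.
Implicit Types u w : R -> R.

(** The derivative is a parameter, so that the derivatives of sums and products
    appear in the explicit form in which they are integrated later. *)
Definition C1_with u u' := (forall x, is_derive x (1 : R) u (u' x)) /\ continuous u'.

Lemma C1_continuous u u' : C1_with u u' -> continuous u.
Proof.
move=> [du _] x; apply/differentiable_continuous/derivable1_diffP.
by have [] := du x.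
Qed.

Lemma C1_cst (c : R) : C1_with (fun=> c) (fun=> 0).
Proof. split=> [x|]; [exact: is_derive_cst|exact: cst_continuous]. Qed.

Lemma C1D u u' w w' : C1_with u u' -> C1_with w w' ->
  C1_with (fun x => u x + w x) (fun x => u' x + w' x).
Proof.
move=> [du cu] [dw cw]; split=> x; first exact: is_deriveD.
by apply: cvgD; [exact: cu|exact: cw].
Qed.

Lemma C1M u u' w w' : C1_with u u' -> C1_with w w' ->
  C1_with (fun x => u x * w x) (fun x => u x * w' x + w x * u' x).
Proof.
move=> Du Dw; have [du cu] := Du; have [dw cw] := Dw; split=> x.
  exact: is_deriveM.
apply: cvgD; apply: cvgM.
- exact: (C1_continuous Du).
- exact: cw.
- exact: (C1_continuous Dw).
- exact: cu.
Qed.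

Lemma C1Z a u u' : C1_with u u' -> C1_with (fun x => a * u x) (fun x => a * u' x).
Proof.
move=> /(C1M (C1_cst a)); congr C1_with; apply/funext => x.
by rewrite mulr0 addr0.
Qed.

Lemma C1_comp u u' w w' : C1_with u u' -> C1_with w w' ->
  C1_with (fun x => u (w x)) (fun x => u' (w x) * w' x).
Proof.
move=> [du cu] Dw; have [dw cw] := Dw; split=> x.
  exact: is_derive1_comp.
apply: cvgM; last exact: cw.
by apply: continuous_comp; [exact: (C1_continuous Dw)|exact: cu].
Qed.

Lemma is_derive_sum_fun (I : Type) (s : seq I) (F : I -> R -> R) (dF : I -> R)
    (x : R) : (forall i, is_derive x (1 : R) (F i) (dF i)) ->
  is_derive x (1 : R) (fun y => \sum_(i <- s) F i y) (\sum_(i <- s) dF i).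
Proof.
move=> DF; elim: s => [|i s IHs].
  by under eq_fun do rewrite big_nil; rewrite big_nil; exact: is_derive_cst.
under eq_fun do rewrite big_cons; rewrite big_cons.
exact: (is_deriveD (DF i) IHs).
Qed.

Lemma C1_sum (I : Type) (s : seq I) (F F' : I -> R -> R) :
  (forall i, C1_with (F i) (F' i)) ->
  C1_with (fun x => \sum_(i <- s) F i x) (fun x => \sum_(i <- s) F' i x).
Proof.
move=> DF; split=> [x|]; first by apply: is_derive_sum_fun => i; case: (DF i).
apply: (@sum_closed _ _ (fun g : R -> R => continuous g) _ _ F').
- exact: cst_continuous.
- by move=> g h cg ch x; apply: cvgD; [exact: cg|exact: ch].
- by move=> i; case: (DF i).
Qed.

Lemma C1_horner (p : {poly R}) : C1_with (horner p) (horner p^`()).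
Proof. by split=> [x|]; [exact: is_derive_poly|exact: continuous_horner]. Qed.

Lemma C1_expR : C1_with (@expR R) (@expR R).
Proof. by split=> [x|]; [exact: is_derive_expR|exact: continuous_expR]. Qed.

Lemma C1_sin : C1_with (@sin R) (@cos R).
Proof. by split=> [x|]; [exact: is_derive_sin|exact: continuous_cos]. Qed.

Lemma C1_cos : C1_with (@cos R) (fun x => - sin x).
Proof.
split=> [x|x]; first exact: is_derive_cos.
by apply: cvgN; exact: continuous_sin.
Qed.

Lemma C1_id : C1_with (fun x => x) (fun=> 1).
Proof. by split=> [x|]; [exact: is_derive_id|exact: cst_continuous]. Qed.

End C1.

(** * The two bases *)

Section Bases.
Context {R : realType}.

(** Each family consists of polynomials, up to an affine change of variable or a
    Gaussian factor. *)
Lemma velocity_basis_C1 (vmin vmax : R) (phi : nat -> R -> R) :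
  velocity_basis vmin vmax phi -> exists phi', forall n, C1_with (phi n) (phi' n).
Proof.
move=> H; suff : forall n, exists p', C1_with (phi n) p'.
  by move=> /choice[phi' ?]; exists phi'.
pose gauss (v : R) := - (v ^+ 2) / 2.
have [gauss' Dgauss] : exists g', C1_with gauss g'.
  exists (fun v => (- 2^-1) * (v * 1 + v * 1)).
  have := C1Z (- 2^-1) (C1M (@C1_id R) (@C1_id R)).
  by congr C1_with; apply/funext => v; rewrite /gauss expr2 !mulNr mulrC.
case: H => [[c E]|[c E]|[p _ E]] n.
- have [a' Da] : exists a',
      C1_with (fun v => (2 * v - vmin - vmax) / (vmax - vmin)) a'.
    eexists; have := C1Z (vmax - vmin)^-1
      (C1D (C1Z 2 (@C1_id R)) (C1_cst (- vmin - vmax))).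
    by congr C1_with; apply/funext => v; rewrite mulrC addrA.
  eexists; have := C1Z (c n) (C1_comp (C1_horner (legendre n)) Da).
  by congr C1_with; apply/funext => v; rewrite E.
- eexists; have := C1M (C1Z (c n) (C1_horner (hermite n))) (C1_comp C1_expR Dgauss).
  by congr C1_with; apply/funext => v; rewrite E.
- eexists; have := C1M (C1_horner (p n)) (C1_comp C1_expR Dgauss).
  by congr C1_with; apply/funext => v; rewrite E.
Qed.

Lemma Re_mul (a b : R[i]) : complex.Re (a * b) =
  complex.Re a * complex.Re b - complex.Im a * complex.Im b.
Proof. by case: a; case: b. Qed.

Lemma Im_mul (a b : R[i]) : complex.Im (a * b) =
  complex.Re a * complex.Im b + complex.Im a * complex.Re b.
Proof. by case: a; case: b. Qed.

Lemma Re_add (a b : R[i]) : complex.Re (a + b) = complex.Re a + complex.Re b.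
Proof. by case: a; case: b. Qed.

Lemma Im_add (a b : R[i]) : complex.Im (a + b) = complex.Im a + complex.Im b.
Proof. by case: a; case: b. Qed.

Lemma Re_sum (I : Type) (s : seq I) (F : I -> R[i]) :
  complex.Re (\sum_(i <- s) F i) = \sum_(i <- s) complex.Re (F i).
Proof. by elim: s => [|i s IHs]; rewrite ?big_nil// !big_cons Re_add IHs. Qed.

Lemma Re_eta k (x : R) :
  complex.Re (eta k x) = (Num.sqrt (2 * pi))^-1 * cos (k%:~R * x).
Proof. by rewrite Re_mul/= mul0r subr0. Qed.

Lemma Im_eta k (x : R) :
  complex.Im (eta k x) = (Num.sqrt (2 * pi))^-1 * sin (k%:~R * x).
Proof. by rewrite Im_mul/= mul0r addr0. Qed.

Lemma sincos_int_period (k : int) :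
  cos (k%:~R * (2 * pi)) = 1 :> R /\ sin (k%:~R * (2 * pi)) = 0 :> R.
Proof.
have nat_case (n : nat) : cos (n%:R * (2 * pi)) = 1 :> R /\
    sin (n%:R * (2 * pi)) = 0 :> R.
  elim: n => [|n [IHc IHs]]; first by rewrite mul0r cos0 sin0.
  rewrite -natr1 mulrDl mul1r cosD sinD IHc IHs [2 * pi]mulr_natl.
  by rewrite cos2pi sin2pi !mul0r mulr1 subr0 mulr0 addr0.
case: k => n; first exact: nat_case.
have [c s] := nat_case n.+1.
by rewrite NegzE mulrNz mulNr cosN sinN c s oppr0.
Qed.

Lemma spaceF_C1 NF (g : R -> R[i]) : spaceF NF g ->
  (exists u', C1_with (fun x => complex.Re (g x)) u') /\
  complex.Re (g (2 * pi)) = complex.Re (g 0).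
Proof.
move=> [c gE]; split; last first.
  rewrite !gE !Re_sum; apply: eq_bigr => j _.
  rewrite [LHS]Re_mul [RHS]Re_mul !Re_eta !Im_eta.
  by have [-> ->] := sincos_int_period (j%:Z - NF%:Z);
    rewrite !mulr0 cos0 sin0 ?mulr0.
pose k (j : nat) : int := j%:Z - NF%:Z.
suff /choice[F' DF] : forall j : nat, exists u',
    C1_with (fun x => complex.Re (c (k j) * eta (k j) x)) u'.
  eexists; have := C1_sum (index_iota 0 (2 * NF).+1) DF.
  by congr C1_with; apply/funext => x; rewrite gE Re_sum.
move=> j; pose r : R := (Num.sqrt (2 * pi))^-1.
have Dkx := C1Z (k j)%:~R (@C1_id R).
eexists; have := C1D (C1Z (complex.Re (c (k j)) * r) (C1_comp C1_cos Dkx))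
  (C1Z (- (complex.Im (c (k j)) * r)) (C1_comp C1_sin Dkx)).
by congr C1_with; apply/funext => x; rewrite Re_mul Re_eta Im_eta mulNr !mulrA.
Qed.

(** Grouping the double sum by n is what separates the variables: for a real
    phi_n, the real part falls on the trigonometric coefficient alone. *)
Lemma spaceX_separated NS NF phi (g : R * R -> R[i]) : spaceX NS NF phi g ->
  exists u : nat -> R -> R, (forall n, (exists u', C1_with (u n) u') /\
      u n (2 * pi) = u n 0) /\
    forall z, complex.Re (g z) = \sum_(0 <= n < NS) u n z.1 * phi n z.2.
Proof.
move=> [c gE].
exists (fun n x => complex.Re
  (\sum_(0 <= j < (2 * NF).+1) c (j%:Z - NF%:Z) n * eta (j%:Z - NF%:Z) x)).
split=> [n|z].
  by apply: (@spaceF_C1 NF); exists (fun k => c k n).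
rewrite gE exchange_big/= Re_sum; apply: eq_bigr => n _.
rewrite !Re_sum mulr_suml; apply: eq_bigr => j _.
by rewrite mulrA [LHS]Re_mul/= mulr0 subr0.
Qed.

End Bases.

(** * Integration over phase space *)

Lemma Rintegral_lincomb d (X : measurableType d) (R : realType)
    (nu : {measure set X -> \bar R}) (D : set X) (I : Type) (s : seq I)
    (a : I -> R) (F : I -> X -> R) :
  measurable D -> (forall i, nu.-integrable D (EFin \o F i)) ->
  \int[nu]_(x in D) (\sum_(i <- s) a i * F i x) =
  \sum_(i <- s) a i * \int[nu]_(x in D) F i x.
Proof.
move=> mD iF; have iaF i : nu.-integrable D (EFin \o (fun x => a i * F i x)).
  rewrite (_ : _ \o _ = fun x => (a i)%:E * (F i x)%:E)%E.
    exact: (integrableZl mD (a i) (iF i)).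
  by apply/funext => x; rewrite /= EFinM.
elim: s => [|i s IHs].
  under eq_Rintegral do rewrite big_nil.
  by rewrite big_nil /Rintegral integral0.
under eq_Rintegral do rewrite big_cons.
rewrite big_cons RintegralD// ?IHs ?RintegralZl//.
rewrite (_ : _ \o _ = fun x => \sum_(j <- s) (a j * F j x)%:E)%E.
  exact: (@integrable_sum _ _ _ nu D mD I s xpredT
    (fun j x => (a j * F j x)%:E) (fun j _ => iaF j)).
by apply/funext => x; rewrite /= sumEFin.
Qed.

Section PhaseSpace.
Context {R : realType}.
Local Notation RR := (measurableTypeR R * measurableTypeR R)%type.
Local Notation mu := (@lebesgue_measure R).
Implicit Types (g h : R * R -> R) (u : R -> R).

(** Measurability refers to the product sigma-algebra, in which Fubini's theorem
    is stated; carried along with continuity, it spares the comparison of that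
    sigma-algebra with the Borel sets of the plane. *)
Definition contmeas g := continuous g /\ measurable_fun setT (g : RR -> R).

Lemma contmeas_cst (c : R) : contmeas (fun=> c).
Proof. by split; [exact: cst_continuous|exact: measurable_cst]. Qed.

Lemma contmeasD g h : contmeas g -> contmeas h -> contmeas (fun z => g z + h z).
Proof.
move=> [cg mg] [ch mh]; split; last exact: measurable_funD.
by move=> z; apply: cvgD; [exact: cg|exact: ch].
Qed.

Lemma contmeasM g h : contmeas g -> contmeas h -> contmeas (fun z => g z * h z).
Proof.
move=> [cg mg] [ch mh]; split; last exact: measurable_funM.
by move=> z; apply: cvgM; [exact: cg|exact: ch].
Qed.

Lemma contmeasN g : contmeas g -> contmeas (fun z => - g z).
Proof.
move=> /(contmeasM (contmeas_cst (-1))).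
by congr contmeas; apply/funext => z; rewrite mulN1r.
Qed.

Lemma contmeasB g h : contmeas g -> contmeas h -> contmeas (fun z => g z - h z).
Proof. by move=> cg /contmeasN; exact: contmeasD. Qed.

Lemma contmeas_sum (I : Type) (s : seq I) (F : I -> R * R -> R) :
  (forall i, contmeas (F i)) -> contmeas (fun z => \sum_(i <- s) F i z).
Proof. by apply: sum_closed; [exact: contmeas_cst|exact: contmeasD]. Qed.

Lemma contmeas_fst u : continuous u -> contmeas (fun z => u z.1).
Proof.
move=> cu; split=> [z|].
  by apply: (@continuous_comp _ _ _ fst u); [exact: cvg_fst|exact: cu].
apply: (measurableT_comp (f := u)); last exact: measurable_fst.
exact: continuous_measurable_fun.
Qed.

Lemma contmeas_snd u : continuous u -> contmeas (fun z => u z.2).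
Proof.
move=> cu; split=> [z|].
  by apply: (@continuous_comp _ _ _ snd u); [exact: cvg_snd|exact: cu].
apply: (measurableT_comp (f := u)); last exact: measurable_snd.
exact: continuous_measurable_fun.
Qed.

Variables vmin vmax : R.
Local Notation Om := (Omega vmin vmax).
Local Notation Ox := (@Omegax R).
Local Notation Ov := (Omegav vmin vmax).

Lemma measurable_Omegax : measurable (Ox : set (measurableTypeR R)).
Proof. exact: measurable_itv. Qed.

Lemma measurable_Omegav : measurable (Ov : set (measurableTypeR R)).
Proof. exact: measurable_itv. Qed.

Lemma measurable_Omega : measurable (Om : set RR).
Proof. by apply: measurableX; [exact: measurable_Omegax|exact: measurable_Omegav]. Qed.

Lemma pi2_gt0 : 0 < 2 * pi :> R.
Proof. by rewrite mulr_gt0// pi_gt0. Qed.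

Lemma leb2_Omega_fin : (leb2 Om < +oo)%E.
Proof.
rewrite /leb2/= product_measure1E; [|exact: measurable_Omegax|exact: measurable_Omegav].
have mE a b (ba bb : bool) :
    (mu [set` Interval (BSide ba a) (BSide bb b)] < +oo)%E.
  by rewrite lebesgue_measure_itv/=; case: ifP => // _; rewrite -EFinB ltry.
by apply: lte_mul_pinfty; rewrite ?ge0_fin_numE//; exact: mE.
Qed.

Lemma integrable_Omega g : contmeas g -> leb2.-integrable Om (EFin \o g).
Proof.
move=> [cg mg]; apply: measurable_bounded_integrable.
- exact: measurable_Omega.
- exact: leb2_Omega_fin.
- exact: measurable_funTS.
- have /compact_bounded : compact (g @` (`[0, 2 * pi] `*` `[vmin, vmax])).
    apply: continuous_compact; first exact: continuous_subspaceT.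
    by apply: compact_setX; exact: segment_compact.
  move=> [M [Mr HM]]; exists M; split=> // x Mx z [z1 z2].
  have zc : (`[0, 2 * pi] `*` `[vmin, vmax]) z.
    by split; [exact: subset_itv_co_cc z1|exact: subset_itv_oo_cc z2].
  by have := HM x Mx (g z); apply; exists z.
Qed.

Lemma section1_continuous g x : continuous g -> continuous (fun v => g (x, v)).
Proof.
move=> cg v; apply: (@continuous_comp _ _ _ (fun v => (x, v)) g); last exact: cg.
have := @cvg_pair _ _ _ (nbhs v) (nbhs x) (nbhs v) _ _ _ (fun=> x) id.
by apply; [exact: cvg_cst|exact: cvg_id].
Qed.

Lemma section2_continuous g v : continuous g -> continuous (fun x => g (x, v)).
Proof.
move=> cg x; apply: (@continuous_comp _ _ _ (fun x => (x, v)) g); last exact: cg.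
have := @cvg_pair _ _ _ (nbhs x) (nbhs x) (nbhs v) _ _ _ id (fun=> v).
by apply; [exact: cvg_id|exact: cvg_cst].
Qed.

Lemma integrable_itv (a b : R) (ba bb : bool) u : continuous u ->
  mu.-integrable [set` Interval (BSide ba a) (BSide bb b)] (EFin \o u).
Proof.
move=> cu; apply: (@integrableS _ _ _ mu `[a, b]).
- exact: measurable_itv.
- exact: measurable_itv.
- move=> x/=; case: ba bb => -[]/=; rewrite !in_itv/= => /andP[? ?];
    by apply/andP; split=> //; exact: ltW.
- apply: continuous_compact_integrable; first exact: segment_compact.
  exact: continuous_subspaceT.
Qed.

Lemma integrable_restrict_Omega g : contmeas g ->
  (@lebesgue_measure R \x @lebesgue_measure R)%E.-integrable [set: RR]
    ((EFin \o g) \_ Om).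
Proof.
move=> /integrable_Omega ig; apply/(integrable_mkcond _ measurable_Omega).
exact: ig.
Qed.

Lemma Fubini_Omega12 g : contmeas g ->
  \int[leb2]_(z in Om) g z = \int[mu]_(x in Ox) \int[mu]_(v in Ov) g (x, v).
Proof.
move=> cg; rewrite /Rintegral integral_mkcond /leb2/=.
rewrite -(integral12_prod_meas1 (integrable_restrict_Omega cg)).
congr fine; rewrite [RHS]integral_mkcond; apply: eq_integral => x _.
rewrite /fubini_F/= patchE; case: ifPn => xO.
  rewrite fineK; last first.
    apply: integrable_fin_num; first exact: measurable_Omegav.
    by apply: integrable_itv; apply: section1_continuous; case: cg.
  rewrite [RHS]integral_mkcond; apply: eq_integral => v _; rewrite !patchE/=.
  by rewrite in_setX/= xO.
by apply: integral0_eq => v _; rewrite patchE in_setX/= (negbTE xO).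
Qed.

Lemma Fubini_Omega21 g : contmeas g ->
  \int[leb2]_(z in Om) g z = \int[mu]_(v in Ov) \int[mu]_(x in Ox) g (x, v).
Proof.
move=> cg; rewrite /Rintegral integral_mkcond /leb2/=.
rewrite -(integral21_prod_meas1 (integrable_restrict_Omega cg)).
congr fine; rewrite [RHS]integral_mkcond; apply: eq_integral => v _.
rewrite /fubini_G/= patchE; case: ifPn => vO.
  rewrite fineK; last first.
    apply: integrable_fin_num; first exact: measurable_Omegax.
    by apply: integrable_itv; apply: section2_continuous; case: cg.
  rewrite [RHS]integral_mkcond; apply: eq_integral => x _; rewrite !patchE/=.
  by rewrite in_setX/= vO andbT.
by apply: integral0_eq => x _; rewrite patchE in_setX/= (negbTE vO) andbF.
Qed.

Lemma integral_OmegaD g h : contmeas g -> contmeas h ->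
  \int[leb2]_(z in Om) (g z + h z) =
  \int[leb2]_(z in Om) g z + \int[leb2]_(z in Om) h z.
Proof.
move=> cg ch; apply: RintegralD; first exact: measurable_Omega.
- exact: integrable_Omega.
- exact: integrable_Omega.
Qed.

Lemma integral_OmegaZ a g : contmeas g ->
  \int[leb2]_(z in Om) (a * g z) = a * \int[leb2]_(z in Om) g z.
Proof.
move=> cg; apply: RintegralZl; first exact: measurable_Omega.
exact: integrable_Omega.
Qed.

Lemma integral_Omega_lincomb (I : Type) (s : seq I) (a : I -> R)
    (F : I -> R * R -> R) : (forall i, contmeas (F i)) ->
  \int[leb2]_(z in Om) (\sum_(i <- s) a i * F i z) =
  \sum_(i <- s) a i * \int[leb2]_(z in Om) F i z.
Proof.
move=> cF; apply: Rintegral_lincomb => [|i]; first exact: measurable_Omega.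
exact: integrable_Omega.
Qed.

(** End points are null sets, so the closed-interval theorem applies to the
    half-open period and to the open velocity interval alike. *)
Lemma FTC_itv (a b : R) (ba bb : bool) (F F' : R -> R) :
  a < b -> C1_with F F' ->
  \int[mu]_(x in [set` Interval (BSide ba a) (BSide bb b)]) F' x = F b - F a.
Proof.
move=> ab DF; have [dF cF'] := DF.
have mF' : measurable_fun `]a, b[ (EFin \o F').
  by apply/measurable_EFinP/measurable_funTS; exact: continuous_measurable_fun.
rewrite /Rintegral integral_itv_bndoo//.
rewrite -[X in fine X](integral_itv_bndoo true false mF').
rewrite (@continuous_FTC2 _ F' F a b ab) -?EFinB//.
- exact: continuous_subspaceT.
- split=> [x _||]; first by have [] := dF x.
  + by apply: cvg_at_right_filter; exact: (C1_continuous DF).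
  + by apply: cvg_at_left_filter; exact: (C1_continuous DF).
- by move=> x _; rewrite derive1E; have [_ ->] := dF x.
Qed.

End PhaseSpace.

(** * Energy identities for the discrete solution *)

Definition product_sum (R : realType) NS (a b : nat -> R -> R) x v :=
  \sum_(0 <= n < NS) a n x * b n v.

Section Identities.
Context {R : realType}.
Local Notation mu := (@lebesgue_measure R).
Variables vmin vmax : R.
Hypothesis hv : vmin < vmax.
Local Notation Om := (Omega vmin vmax).
Local Notation Ox := (@Omegax R).
Local Notation Ov := (Omegav vmin vmax).
Variables (NS : nat) (phi phi' : nat -> R -> R).
Hypothesis Dphi : forall n, C1_with (phi n) (phi' n).
Hypothesis horth : orthonormal_upto vmin vmax NS phi.

(** With b n = phi n w this is the reproducing property of the kernel
    \sum_n phi_n(w) phi_n(v). *)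
Lemma velocity_Parseval (a b : nat -> R) :
  \int[mu]_(v in Ov)
    ((\sum_(0 <= n < NS) a n * phi n v) * (\sum_(0 <= n < NS) b n * phi n v)) =
  \sum_(0 <= n < NS) a n * b n.
Proof.
have cphi n : continuous (phi n) := C1_continuous (Dphi n).
have cp n m : continuous (fun v => phi n v * phi m v).
  by move=> v; apply: cvgM; exact: cphi.
have cb n : continuous (fun v => \sum_(0 <= m < NS) b m * (phi n v * phi m v)).
  apply: (@sum_closed _ _ (fun g : R -> R => continuous g) _ _
    (fun m v => b m * (phi n v * phi m v))).
  - exact: cst_continuous.
  - by move=> g h cg ch v; apply: cvgD; [exact: cg|exact: ch].
  - by move=> m v; apply: cvgM; [exact: cvg_cst|exact: cp].
transitivity (\sum_(0 <= n < NS) a n *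
    \int[mu]_(v in Ov) (\sum_(0 <= m < NS) b m * (phi n v * phi m v))).
  rewrite -Rintegral_lincomb; first last.
  - by move=> n; exact: integrable_itv.
  - exact: measurable_Omegav.
  apply: eq_Rintegral => v _; rewrite mulr_suml; apply: eq_bigr => n _.
  rewrite -mulrA; congr (_ * _); rewrite mulr_sumr.
  by apply: eq_bigr => m _; rewrite mulrCA.
apply: eq_big_nat => n /andP[_ nNS]; congr (_ * _).
rewrite Rintegral_lincomb; first last.
- by move=> m; exact: integrable_itv.
- exact: measurable_Omegav.
transitivity (\sum_(0 <= m < NS) b m * (n == m)%:R).
  by apply: eq_big_nat => m /andP[_ mNS]; rewrite horth.
rewrite (bigD1_seq n) ?iota_uniq ?mem_index_iota//= eqxx mulr1.
by rewrite big1 ?addr0// => m; rewrite eq_sym => /negPf ->; rewrite mulr0.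
Qed.

Variables (u u' : nat -> R -> R) (E : R -> R).
Hypothesis Du : forall n, C1_with (u n) (u' n).
Hypothesis u_per : forall n, u n (2 * pi) = u n 0.
Hypothesis cE : continuous E.

Local Notation F := (product_sum NS u phi).
Local Notation Fx := (product_sum NS u' phi).
Local Notation Fv := (product_sum NS u phi').

Lemma state_C1_x v : C1_with (F^~ v) (Fx^~ v).
Proof.
apply: (@C1_sum _ _ _ (fun n x => u n x * phi n v) (fun n x => u' n x * phi n v)).
move=> n; have := C1Z (phi n v) (Du n).
by congr C1_with; apply/funext => x; rewrite mulrC.
Qed.

Lemma state_C1_v x : C1_with (F x) (Fv x).
Proof.
apply: (@C1_sum _ _ _ (fun n v => u n x * phi n v) (fun n v => u n x * phi' n v)).
by move=> n; exact: C1Z.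
Qed.

Lemma contmeas_product_sum (a b : nat -> R -> R) :
  (forall n, continuous (a n)) -> (forall n, continuous (b n)) ->
  contmeas (fun z : R * R => \sum_(0 <= n < NS) a n z.1 * b n z.2).
Proof.
move=> ca cb.
apply: (@contmeas_sum _ _ _ (fun n (z : R * R) => a n z.1 * b n z.2)) => n.
by apply: contmeasM; [exact: contmeas_fst|exact: contmeas_snd].
Qed.

Lemma contmeas_state : contmeas (fun z => F z.1 z.2).
Proof.
apply: contmeas_product_sum => n; first exact: (C1_continuous (Du n)).
exact: (C1_continuous (Dphi n)).
Qed.

Lemma contmeas_state_dx : contmeas (fun z => Fx z.1 z.2).
Proof.
by apply: contmeas_product_sum => n; [case: (Du n)|exact: (C1_continuous (Dphi n))].
Qed.

Lemma contmeas_state_dv : contmeas (fun z => Fv z.1 z.2).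
Proof.
by apply: contmeas_product_sum => n; [exact: (C1_continuous (Du n))|case: (Dphi n)].
Qed.

Lemma C1_half_square (g g' : R -> R) (a : R) : C1_with g g' ->
  C1_with (fun x => a / 2 * g x ^+ 2) (fun x => a * g' x * g x).
Proof.
move=> Dg; have := C1Z (a / 2) (C1M Dg Dg).
by congr C1_with; apply/funext => x; field.
Qed.

(** For fixed v, the integrand is the x-derivative of v F^2 / 2, which is
    periodic. *)
Lemma transport_no_work :
  \int[leb2]_(z in Om) (z.2 * Fx z.1 z.2 * F z.1 z.2) = 0.
Proof.
rewrite Fubini_Omega21//; last first.
  apply: contmeasM contmeas_state; apply: contmeasM contmeas_state_dx.
  by apply: (@contmeas_snd _ (fun v => v)) => v; exact: cvg_id.
transitivity (\int[mu]_(v in Ov) (0 : R)); last by rewrite /Rintegral integral0.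
apply: eq_Rintegral => v _ /=.
rewrite (FTC_itv true true (pi2_gt0) (C1_half_square v (state_C1_x v))).
by rewrite /product_sum; under eq_bigr do rewrite u_per; rewrite subrr.
Qed.

(** For fixed x, the integrand is the v-derivative of E F^2 / 2; phi_n has no
    periodicity, so the boundary flux survives. *)
Lemma field_work :
  \int[leb2]_(z in Om) (E z.1 * Fv z.1 z.2 * F z.1 z.2) =
  2^-1 * \int[mu]_(x in Ox) (E x * (F x vmax ^+ 2 - F x vmin ^+ 2)).
Proof.
rewrite Fubini_Omega12//; last first.
  apply: contmeasM contmeas_state; apply: contmeasM contmeas_state_dv.
  exact: contmeas_fst.
have cF v : continuous (F^~ v) := C1_continuous (state_C1_x v).
have c2 v : continuous (fun x => F x v ^+ 2).
  by move=> x; exact: (cvgM (cF v x) (cF v x)).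
rewrite -RintegralZl; first last.
- apply: integrable_itv => x; apply: cvgM; first exact: cE.
  by apply: cvgB; exact: c2.
- exact: measurable_Omegax.
apply: eq_Rintegral => x _ /=.
by rewrite (FTC_itv false true hv (C1_half_square (E x) (state_C1_v x))); field.
Qed.

(** The boundary term tests to twice the work of [field_work], which is why the
    penalty carries the factor - 1/2. *)
Lemma boundary_work (b : R * R -> R) :
  (forall z, b z = E z.1 *
    (F z.1 vmax * (\sum_(0 <= n < NS) phi n vmax * phi n z.2)
     - F z.1 vmin * (\sum_(0 <= n < NS) phi n vmin * phi n z.2))) ->
  contmeas b /\
  \int[leb2]_(z in Om) (b z * F z.1 z.2) =
  \int[mu]_(x in Ox) (E x * (F x vmax ^+ 2 - F x vmin ^+ 2)).
Proof.
move=> bE; have cF v : continuous (F^~ v) := C1_continuous (state_C1_x v).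
have cphi n : continuous (phi n) := C1_continuous (Dphi n).
have cb : contmeas b.
  rewrite (funext bE); apply: contmeasM; first exact: contmeas_fst.
  have ck v : contmeas (fun z : R * R =>
      F z.1 v * \sum_(0 <= n < NS) phi n v * phi n z.2).
    apply: contmeasM; first exact: (contmeas_fst (cF v)).
    apply: (@contmeas_product_sum (fun n _ => phi n v) phi) => // n.
    exact: cst_continuous.
  by apply: contmeasB; exact: ck.
split=> //; rewrite Fubini_Omega12//; last first.
  by apply: contmeasM cb contmeas_state.
apply: eq_Rintegral => x _ /=.
pose a n := E x * (F x vmax * phi n vmax - F x vmin * phi n vmin).
transitivity (\int[mu]_(v in Ov)
    ((\sum_(0 <= n < NS) a n * phi n v) * (\sum_(0 <= n < NS) u n x * phi n v))).
  apply: eq_Rintegral => v _; congr (_ * _); rewrite bE/=.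
  rewrite !mulr_sumr -sumrB mulr_sumr; apply: eq_bigr => n _.
  by rewrite /a; ring.
rewrite velocity_Parseval /product_sum !expr2 [in RHS]mulr_sumr.
rewrite [X in _ - X]mulr_sumr -sumrB mulr_sumr.
by apply: eq_bigr => n _; rewrite /a /product_sum; ring.
Qed.

End Identities.

(** * Projections and interpolation in the discrete space *)

Section DiscreteSpace.
Context {R : realType}.
Variables (vmin vmax : R) (NS NF : nat) (phi phi' : nat -> R -> R).
Hypothesis Dphi : forall n, C1_with (phi n) (phi' n).
Local Notation Om := (Omega vmin vmax).

(** The integrand is nonnegative, so the square undoes the square root. *)
Lemma L2norm_sqr_real (g : R * R -> R) :
  L2norm leb2 Om (fun z => (g z)%:C) ^+ 2 = \int[leb2]_(z in Om) (g z * g z).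
Proof.
rewrite /L2norm /L2inner /Cintegral/=.
under eq_Rintegral do rewrite mul0r subr0.
by rewrite sqr_sqrtr//; apply: Rintegral_ge0 => z _; rewrite -expr2 sqr_ge0.
Qed.

Definition complex_contmeas : set (R * R -> R[i]) :=
  [set g | contmeas (fun z => complex.Re (g z)) /\
           contmeas (fun z => complex.Im (g z))].

Lemma complex_contmeas0 : complex_contmeas (fun=> 0).
Proof. by split; exact: contmeas_cst. Qed.

Lemma complex_contmeas_lin a g h : complex_contmeas g -> complex_contmeas h ->
  complex_contmeas (fun z => a * g z + h z).
Proof.
move=> [rg ig] [rh ih]; split.
  under eq_fun do rewrite Re_add Re_mul.
  apply: contmeasD rh; apply: contmeasB; apply: contmeasM => //;
    exact: contmeas_cst.
under eq_fun do rewrite Im_add Im_mul.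
apply: contmeasD ih; apply: contmeasD; apply: contmeasM => //;
  exact: contmeas_cst.
Qed.

Lemma eta_phi_contmeas (k : int) n :
  complex_contmeas (fun z => eta k z.1 * (phi n z.2)%:C).
Proof.
have cphi : contmeas (fun z : R * R => phi n z.2).
  exact: contmeas_snd (C1_continuous (Dphi n)).
have Dk := C1Z k%:~R (@C1_id R).
pose r : R := (Num.sqrt (2 * pi))^-1; split.
- under eq_fun do rewrite [complex.Re _]Re_mul Re_eta mulr0 subr0.
  apply: contmeasM cphi.
  exact: (contmeas_fst (C1_continuous (C1Z r (C1_comp C1_cos Dk)))).
- under eq_fun do rewrite [complex.Im _]Im_mul Im_eta mulr0 add0r.
  apply: contmeasM cphi.
  exact: (contmeas_fst (C1_continuous (C1Z r (C1_comp C1_sin Dk)))).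
Qed.

(** Interpolation works with a family over a single index set; here it consists
    of the pairs (j, n). *)
Lemma spaceX_lincomb (g : R * R -> R[i]) : spaceX NS NF phi g ->
  exists c : nat * nat -> R[i], forall z,
  g z = \sum_(q <- [seq (j, n) | j <- index_iota 0 (2 * NF).+1,
                                n <- index_iota 0 NS])
    c q * (eta (q.1%:Z - NF%:Z) z.1 * (phi q.2 z.2)%:C).
Proof.
move=> [c gE]; exists (fun q => c (q.1%:Z - NF%:Z) q.2) => z.
by rewrite gE big_allpairs.
Qed.

Lemma spaceX_Re_contmeas (g : R * R -> R[i]) : spaceX NS NF phi g ->
  contmeas (fun z => complex.Re (g z)).
Proof.
move=> /spaceX_separated[u [Du gE]]; under eq_fun do rewrite gE.
apply: contmeas_product_sum => n; last exact: (C1_continuous (Dphi n)).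
by have [[u' Dun] _] := Du n; exact: (C1_continuous Dun).
Qed.

(** The real parts of complex interpolating functions interpolate every real
    element of the space, because its point values are real. *)
Lemma spaceX_interpolation : exists m (p : nat -> R * R) (g : nat -> R * R -> R),
  (forall i, contmeas (g i)) /\
  forall h, spaceX NS NF phi (fun z => (h z)%:C) ->
    forall z, h z = \sum_(i < m) h (p i) * g i z.
Proof.
have [m [p [g [cg gE]]]] := finite_span_interpolation (0, 0)
  [seq (j, n) | j <- index_iota 0 (2 * NF).+1, n <- index_iota 0 NS]
  complex_contmeas0 complex_contmeas_lin
  (fun q : nat * nat => eta_phi_contmeas (q.1%:Z - NF%:Z) q.2).
exists m, p, (fun i z => complex.Re (g i z)); split=> [i|h].
  by have [] := cg i.
move=> /spaceX_lincomb[c hE] z; have := gE c z; rewrite /= -hE => hz.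
rewrite -[LHS]/(complex.Re (h z)%:C) hz Re_sum; apply: eq_bigr => i _.
by rewrite -hE Re_mul/= mul0r subr0.
Qed.

(** The bridge from the complex orthogonality relations to the real energy
    balance. *)
Lemma projX_real_test (g w : R * R -> R) (P : R * R -> R[i]) :
  projX vmin vmax NS NF phi (fun z => (g z)%:C) P ->
  spaceX NS NF phi (fun z => (w z)%:C) -> contmeas g ->
  \int[leb2]_(z in Om) (g z * w z) =
  \int[leb2]_(z in Om) (complex.Re (P z) * w z).
Proof.
move=> [XP PT] Xw cg; have := congr1 (@complex.Re R) (PT _ Xw).
have cP := spaceX_Re_contmeas XP; have cw := spaceX_Re_contmeas Xw.
rewrite /L2inner /Cintegral/= => H.
have {}H : \int[leb2]_(z in Om) (g z * w z + - 1 * (complex.Re (P z) * w z)) = 0.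
  rewrite -[RHS]H; apply: eq_Rintegral => z _.
  by case: (P z) => a b /=; ring.
move: H; rewrite integral_OmegaD; last 2 first.
- exact: contmeasM.
- by apply: contmeasM; [exact: contmeas_cst|exact: contmeasM].
rewrite integral_OmegaZ; last exact: contmeasM.
by rewrite mulN1r => /eqP; rewrite subr_eq0 => /eqP.
Qed.

End DiscreteSpace.

(** * Conservation of the norm *)

Section Conservation.
Context {R : realType}.
Variables (vmin vmax : R) (NS NF : nat) (phi phi' : nat -> R -> R).
Hypothesis hv : vmin < vmax.
Hypothesis Dphi : forall n, C1_with (phi n) (phi' n).
Hypothesis horth : orthonormal_upto vmin vmax NS phi.
Local Notation Om := (Omega vmin vmax).

(** The energy balance at a fixed time. The transport term does no work, and the
    field term and the penalty contribute opposite halves of the same flux. *)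
Lemma time_derivative_orthogonal (f : R -> R -> R -> R) (E : R -> R -> R) (t : R) :
  spaceX NS NF phi (slice f t) -> spaceF NF (fun x => (E x t)%:C) ->
  contmeas (fun z => derive1 (f z.1 z.2) t) ->
  (exists2 RN : R * R -> R[i],
    is_penalty vmin vmax NS NF phi f E t RN &
    projX vmin vmax NS NF phi (fun z => (vlasov f E t z)%:C) RN) ->
  \int[leb2]_(z in Om) (derive1 (f z.1 z.2) t * f z.1 z.2 t) = 0.
Proof.
move=> Xf /spaceF_C1[[E' DE] _] cft [RN [P PB RNE] PV].
have cE : continuous (fun x => E x t) := C1_continuous DE.
have [u [Hu fE]] := spaceX_separated Xf.
have /choice[u' Du] n : exists u', C1_with (u n) u' by have [] := Hu n.
have u_per n : u n (2 * pi) = u n 0 by have [] := Hu n.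
have fF x v : f x v t = product_sum NS u phi x v := fE (x, v).
have cF := contmeas_state NS Dphi Du.
have cFx := contmeas_state_dx NS Dphi Du.
have cFv := contmeas_state_dv NS Dphi Du.
have cEF : contmeas (fun z => E z.1 t * product_sum NS u phi' z.1 z.2).
  by apply: contmeasM cFv; exact: (contmeas_fst cE).
have cvF : contmeas (fun z => z.2 * product_sum NS u' phi z.1 z.2).
  by apply: contmeasM cFx; apply: (@contmeas_snd _ (fun v => v)) => v; exact: cvg_id.
have VE z : vlasov f E t z = derive1 (f z.1 z.2) t +
    z.2 * product_sum NS u' phi z.1 z.2 - E z.1 t * product_sum NS u phi' z.1 z.2.
  rewrite /vlasov; congr (_ + _ * _ - _ * _); rewrite derive1E.
  - under eq_fun do rewrite fF.
    by have [+ _] := state_C1_x NS phi Du z.2 => /(_ z.1) H; exact: derive_val.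
  - under eq_fun do rewrite fF.
    by have [+ _] := state_C1_v NS Dphi u z.1 => /(_ z.2) H; exact: derive_val.
have cV : contmeas (vlasov f E t).
  by rewrite (funext VE); apply: contmeasB cEF; exact: contmeasD.
have [cB BE] := boundary_work Dphi horth Du cE
  (b := boundary_term vmin vmax NS phi f E t)
  (fun z => ltac:(by rewrite /boundary_term !fF)).
have := projX_real_test Dphi PV Xf cV.
under [X in _ = X]eq_Rintegral do rewrite RNE Re_mul/= oppr0 mul0r subr0 -mulrA.
have XP : spaceX NS NF phi P by case: PB.
have cP := spaceX_Re_contmeas Dphi XP.
have cf : contmeas (fun z => f z.1 z.2 t) by under eq_fun do rewrite fF.
rewrite integral_OmegaZ; last exact: contmeasM.
rewrite -(projX_real_test Dphi PB Xf cB).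
under [X in _ = _ * X]eq_Rintegral do rewrite fF.
rewrite BE.
under eq_Rintegral do rewrite VE mulrDl mulrDl mulNr -mulN1r.
rewrite integral_OmegaD; first last.
- by apply: contmeasM; [exact: contmeas_cst|exact: contmeasM].
- by apply: contmeasD; exact: contmeasM.
rewrite integral_OmegaD; first last.
- exact: contmeasM.
- exact: contmeasM.
rewrite integral_OmegaZ; last exact: contmeasM.
under [X in _ + X + _]eq_Rintegral do rewrite fF.
under [X in _ + _ * X]eq_Rintegral do rewrite fF.
rewrite (transport_no_work vmin vmax NS Dphi Du u_per) (field_work hv NS Dphi Du cE).
by rewrite addr0 mulN1r mulNr => /eqP; rewrite subr_eq addNr => /eqP.
Qed.

Lemma energy_bilinear m (g : nat -> R * R -> R) (a b : nat -> R) :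
  (forall i, contmeas (g i)) ->
  \int[leb2]_(z in Om) ((\sum_(i < m) a i * g i z) * (\sum_(i < m) b i * g i z)) =
  \sum_(i < m) \sum_(k < m) a i * b k * \int[leb2]_(z in Om) (g i z * g k z).
Proof.
move=> cg; have cgg i k : contmeas (fun z => g i z * g k z) by exact: contmeasM.
transitivity (\int[leb2]_(z in Om) (\sum_(i < m) a i *
    (\sum_(k < m) b k * (g i z * g k z)))).
  apply: eq_Rintegral => z _; rewrite mulr_suml; apply: eq_bigr => i _.
  rewrite -mulrA; congr (_ * _); rewrite mulr_sumr; apply: eq_bigr => k _.
  by rewrite mulrCA.
rewrite (@integral_Omega_lincomb _ vmin vmax _ _ (fun i : 'I_m => a i)
  (fun i z => \sum_(k < m) b k * (g i z * g k z))); last first.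
  move=> i; apply: (@contmeas_sum _ _ _
    (fun (k : 'I_m) z => b k * (g i z * g k z))) => k.
  by apply: contmeasM; first exact: contmeas_cst.
apply: eq_bigr => i _.
rewrite (@integral_Omega_lincomb _ vmin vmax _ _ (fun k : 'I_m => b k)
  (fun k z => g i z * g k z))//.
by rewrite mulr_sumr; apply: eq_bigr => k _; rewrite mulrA.
Qed.

End Conservation.

Unset Implicit Arguments.

Theorem theorem3p3 (R : realType) (vmin vmax T : R) (NS NF : nat)
    (phi : nat -> R -> R) (f0 : R -> R -> R) (Pf0 : R * R -> R[i])
    (f : R -> R -> R -> R) (E : R -> R -> R)
    (hv : vmin < vmax) (hT : 0 < T) (hNS : (0 < NS)%N) (hNF : (0 < NF)%N)
    (hphi : velocity_basis vmin vmax phi)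
    (horth : orthonormal_upto vmin vmax NS phi)
    (hf0 : L2_Omega vmin vmax f0)
    (hsol : truncated_vlasov_poisson vmin vmax T NS NF phi f0 Pf0 f E) :
  (forall t : R, 0 < t < T ->
     is_derive t (1 : R)
       (fun s : R => L2norm leb2 (Omega vmin vmax) (slice f s) ^+ 2) 0) /\
  (forall t : R, 0 <= t < T ->
     L2norm leb2 (Omega vmin vmax) (slice f t)
     = L2norm leb2 (Omega vmin vmax) Pf0).
Proof.
have [phi' Dphi] := velocity_basis_C1 hphi.
have [Xf FE cf df PV _ _ _ _ init] := hsol.
have [m [p [g [cg interp]]]] := spaceX_interpolation NS NF Dphi.
pose a (i : nat) := f (p i).1 (p i).2.
(* The Gram matrix of the interpolating functions, constant in time. *)
pose G i k := \int[leb2]_(z in Omega vmin vmax) (g i z * g k z).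
pose Q s := \sum_(i < m) \sum_(k < m) a i s * a k s * G i k.
have fa s : 0 <= s < T -> forall x v, f x v s = \sum_(i < m) a i s * g i (x, v).
  by move=> sT x v; exact: (interp (fun z => f z.1 z.2 s) (Xf _ sT) (x, v)).
have NQ s : 0 <= s < T -> L2norm leb2 (Omega vmin vmax) (slice f s) ^+ 2 = Q s.
  move=> sT; rewrite L2norm_sqr_real /Q /G.
  rewrite -(energy_bilinear vmin vmax m (fun i => a i s) (fun i => a i s) cg).
  by apply: eq_Rintegral => -[x v] _ /=; rewrite fa.
have nearT t : 0 < t < T -> \forall s \near t, 0 <= s < T.
  move=> tT; have : t \in `]0, T[ by rewrite in_itv.
  move=> /near_in_itvoo; apply: filterS => s; rewrite in_itv/= => /andP[s0 ->].
  by rewrite ltW.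
have da i t : 0 < t < T -> is_derive t (1 : R) (a i) ((a i)^`()%classic t).
  by move=> tT; rewrite derive1E; exact/derivableP/df.
have Qder t : 0 < t < T -> is_derive t (1 : R) Q 0.
  move=> tT; have /andP[t0 tltT] := tT.
  have t0T : 0 <= t < T by rewrite ltW.
  have ft x v : (f x v)^`()%classic t = \sum_(i < m) (a i)^`()%classic t * g i (x, v).
    rewrite [LHS]derive1E; apply: derive_val.
    apply: (@near_eq_is_derive _ _ _ (fun s => \sum_(i < m) a i s * g i (x, v))).
      by apply: filterS (nearT _ tT) => s sT; rewrite fa.
    apply: is_derive_sum_fun => i; have dai := da i t tT.
    have := is_deriveM dai (is_derive_cst (g i (x, v)) t 1).
    by move=> H; apply: trigger_derive H _; rewrite scaler0 add0r /GRing.scale/= mulrC.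
  have ft_orth := time_derivative_orthogonal hv Dphi horth
    (Xf _ t0T) (FE _ t0T) _ (PV _ tT).
  (* The interpolation formula makes the time derivative continuous in (x, v). *)
  have cft : contmeas (fun z => derive1 (f z.1 z.2) t).
    under eq_fun do rewrite ft.
    apply: (@contmeas_sum _ _ _
      (fun (i : 'I_m) z => (a i)^`()%classic t * g i (z.1, z.2))) => i.
    apply: contmeasM; first exact: contmeas_cst.
    by rewrite (_ : (fun _ => _) = g i)//; apply/funext => -[].
  have orth : \sum_(i < m) \sum_(k < m) (a i)^`()%classic t * a k t * G i k = 0.
    rewrite -[RHS](ft_orth cft) /G.
    rewrite -(energy_bilinear vmin vmax m (fun i => (a i)^`()%classic t)
      (fun i => a i t) cg).
    by apply: eq_Rintegral => -[x v] _ /=; rewrite ft fa.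
  have Gsym i k : G i k = G k i.
    by apply: eq_Rintegral => z _; rewrite mulrC.
  have D : is_derive t (1 : R) Q (\sum_(i < m) \sum_(k < m)
      ((a i)^`()%classic t * a k t * G i k + (a k)^`()%classic t * a i t * G k i)).
    apply: is_derive_sum_fun => i; apply: is_derive_sum_fun => k.
    have := is_deriveM (is_deriveM (da i t tT) (da k t tT))
      (is_derive_cst (G i k) t 1).
    move=> H; apply: trigger_derive H _.
    rewrite scaler0 add0r (Gsym k i) /GRing.scale/=; ring.
  apply: trigger_derive D _.
  under eq_bigr do rewrite big_split.
  by rewrite big_split/= orth [X in _ + X]exchange_big/= orth addr0.
split=> t tT.
  apply: (@near_eq_is_derive _ _ _ Q); last exact: Qder.
  by apply: filterS (nearT _ tT) => s sT; rewrite NQ.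
have /andP[] := tT; rewrite le_eqVlt => /predU1P[<- _|t0 tltT]; first by rewrite init.
have T0 : 0 <= (0 : R) < T by rewrite hT andbT.
rewrite -init; apply/eqP; rewrite -(eqrXn2 (n := 2))// ?sqrtr_ge0// !NQ//; apply/eqP.
have cQ : {within `[0, t], continuous Q}.
  have sub : `[0, t] `<=` `[0, T[.
    by move=> s /=; rewrite !in_itv/= => /andP[-> st]; exact: le_lt_trans st tltT.
  have ca i : {within `[0, t], continuous (a i)}.
    exact: continuous_subspaceW sub (cf _ _).
  pose V := [set h : R -> R | {within `[0, t], continuous h}].
  have V0 : V (fun=> 0) by move=> s; exact: cvg_cst.
  have VD h1 h2 : V h1 -> V h2 -> V (fun s => h1 s + h2 s).
    by move=> c1 c2 s; apply: cvgD; [exact: c1|exact: c2].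
  have VM h1 h2 : V h1 -> V h2 -> V (fun s => h1 s * h2 s).
    by move=> c1 c2 s; apply: cvgM; [exact: c1|exact: c2].
  apply: (@sum_closed _ _ V _ _
    (fun (i : 'I_m) s => \sum_(k < m) a i s * a k s * G i k)) => // i.
  apply: (@sum_closed _ _ V _ _ (fun (k : 'I_m) s => a i s * a k s * G i k)) => // k.
  by apply: (VM _ _ (VM _ _ (ca i) (ca k))) => s; exact: cvg_cst.
have [|c _] := MVT (df := fun=> 0) t0 _ cQ.
  move=> s; rewrite in_itv/= => /andP[s0 st]; apply: Qder.
  by rewrite s0 (lt_trans st tltT).
by rewrite mul0r => /eqP; rewrite subr_eq0 => /eqP.
Qed.
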